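(* For every positive integer $n$, let $\mathcal T_n$ denote the set of tree-like tableaux of size $n$. Then the total number of occupied corners over all tree-like tableaux of size $n$ is $$oc(\mathcal T_n)=\sum_{T\in\mathcal T_n} oc(T)=n!.$$ (Equivalently, since $|\mathcal T_n|=n!$, on average there is exactly one occupied corner per tree-like tableau of size $n$.)
   Context: A tree-like tableau is a filling of a Young diagram (English convention: rows left-justified, row lengths weakly decreasing from top to bottom) in which some cells contain a point, subject to: (1) the top-left cell contains a point (the root point); (2) for each non-root point, there is a point above it in the same column or a point to its left in the same row, but not both; (3) there is no empty row and no empty column. The size of a tree-like tableau is its number of points. It is known that there are $n!$ tree-like tableaux of size $n$. A corner of a tree-like tableau $T$ is a cell whose bottom edge and right edge both lie on the Southeast boundary of the diagram. A corner is occupied if it contains a point; $oc(T)$ is the number of occupied corners of $T$. *)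

(* Defs.v *)
From HB Require Import structures.
From mathcomp Require Import all_boot.

Set Implicit Arguments.
Unset Strict Implicit.
Unset Printing Implicit Defensive.

(* A filling of a Young diagram is given by its rows, from top to bottom; each *)
(* row lists its cells from left to right, [true] marking a cell with a point. *)
(* Cells [(i, j)] are indexed from 0: [i] is the row and [j] the column.       *)
Definition filling := seq (seq bool).

Section Filling.

Variable T : filling.

Definition row_length (i : nat) : nat := size (nth [::] T i).

Definition is_cell (i j : nat) : bool := j < row_length i.

Definition is_point (i j : nat) : bool := nth false (nth [::] T i) j.

Definition young_diagram : bool :=
  sorted geq (map size T) && (0 \notin map size T).

Definition point_above (i j : nat) : bool := [exists i' : 'I_i, is_point i' j].

Definition point_left (i j : nat) : bool := [exists j' : 'I_j, is_point i j'].

Definition root_condition : bool := is_point 0 0.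

Definition nonroot_condition : bool :=
  [forall i : 'I_(size T), forall j : 'I_(row_length i),
     is_point i j && ((i : nat, j : nat) != (0, 0)) ==>
     point_above i j (+) point_left i j].

Definition no_empty_row : bool :=
  [forall i : 'I_(size T), exists j : 'I_(row_length i), is_point i j].

Definition no_empty_column : bool :=
  [forall j : 'I_(row_length 0), exists i : 'I_(size T), is_point i j].

Definition tree_like : bool :=
  [&& young_diagram, root_condition, nonroot_condition,
      no_empty_row & no_empty_column].

Definition num_points : nat :=
  \sum_(i < size T) \sum_(j < row_length i) is_point i j.

Definition is_corner (i j : nat) : bool :=
  [&& is_cell i j, ~~ is_cell i.+1 j & ~~ is_cell i j.+1].

Definition oc : nat :=
  \sum_(i < size T) \sum_(j < row_length i) (is_corner i j && is_point i j).

End Filling.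

Record tlt (n : nat) := TLT {
  tlt_filling :> filling;
  tlt_prop : tree_like tlt_filling && (num_points tlt_filling == n)
}.

HB.instance Definition _ n := [isSub for @tlt_filling n].
HB.instance Definition _ n := [Countable of tlt n by <:].

(* Finiteness: having no empty row and no empty column, a tree-like tableau    *)
(* with [n] points has at most [n] rows and at most [n] columns.               *)

Lemma size_rows_le T : no_empty_row T -> size T <= num_points T.
Proof.
move=> /forallP rowT; rewrite /num_points -{1}(card_ord (size T)) -sum1_card.
apply: leq_sum => i _; have /existsP[j Tij] := rowT i.
by rewrite (bigD1 j) //= Tij.
Qed.

Lemma row_length_le T i : young_diagram T -> row_length T i <= row_length T 0.
Proof.
case/andP=> srtT _; have [ltiT | leTi] := ltnP i (size T); last first.
  by rewrite /row_length nth_default.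
have T_gt0 := leq_ltn_trans (leq0n i) ltiT.
rewrite /row_length -!(nth_map _ 0) //.
have geq_tr : transitive geq by move=> y x z /= yx zy; apply: leq_trans zy yx.
by apply: (sorted_leq_nth geq_tr leqnn 0 srtT 0 i); rewrite ?inE ?size_map.
Qed.

Lemma size_columns_le T :
  young_diagram T -> no_empty_column T -> row_length T 0 <= num_points T.
Proof.
move=> yT /forallP colT.
have -> : num_points T =
    \sum_(i < size T) \sum_(j < row_length T 0) is_point T i j.
  apply: eq_bigr => i _.
  rewrite (big_ord_widen _ (fun j => is_point T i j : nat) (row_length_le i yT)).
  rewrite big_mkcond; apply: eq_bigr => j _; case: ltnP => // leTj.
  by rewrite /is_point nth_default.
rewrite exchange_big /= -{1}(card_ord (row_length T 0)) -sum1_card.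
apply: leq_sum => j _; have /existsP[i Tij] := colT j.
by rewrite (bigD1 i) //= Tij.
Qed.

Definition tlt_enum (n : nat) : seq (tlt n) :=
  undup (pmap insub [seq map val (val b) | b : {bseq n of {bseq n of bool}}]).

Lemma mem_tlt_enum n (T : tlt n) : T \in tlt_enum n.
Proof.
rewrite mem_undup mem_pmap_sub /=.
have /andP[/and5P[yT _ _ rowT colT] /eqP szT] := tlt_prop T.
have rowsT : size (T : filling) <= n by rewrite -[leqRHS]szT size_rows_le.
have colsT : all (fun r : seq bool => size r <= n) (T : filling).
  apply/(all_nthP [::]) => i _; apply: leq_trans (row_length_le i yT) _.
  by rewrite -[leqRHS]szT size_columns_le.
pose rb (r : seq bool) : {bseq n of bool} := insub_bseq n r.
have mapK : map val (map rb (T : filling)) = T :> filling.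
  rewrite -map_comp -[RHS]map_id; apply/eq_in_map => r /(allP colsT) ler.
  by rewrite /= /rb /insub_bseq val_insubd ler.
apply/mapP; exists (insub_bseq n (map rb (T : filling))).
  by rewrite mem_enum.
by rewrite /insub_bseq val_insubd size_map rowsT mapK.
Qed.

HB.instance Definition _ n :=
  isFinite.Build (tlt n) (Finite.uniq_enumP (undup_uniq _) (@mem_tlt_enum n)).

(* Main.v *)
(* Call a cell that can be added to the diagram in a row other than the first  *)
(* one an inner corner; every diagram has one more corner than inner corners.  *)
(* Removing an empty corner cell turns it into an inner corner, and this is    *)
(* reversible, so over all tableaux of size n there are as many empty corners  *)
(* as inner corners; hence the occupied corners are equinumerous with the      *)
(* tableaux themselves. On the other hand, a non-root occupied corner is alone *)
(* in its column (if there is a point to its left) or in its row (if there is  *)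
(* a point above it); deleting that column or row leaves a tableau of size     *)
(* n - 1 with a marked row or column, and every marking arises once. Since a   *)
(* tableau of size n - 1 has n rows and columns in total, both numbers equal   *)
(* n times the number of tableaux of size n - 1, whence n! by induction.       *)

Require Import Defs.
From HB Require Import structures.
From mathcomp Require Import all_boot zify.

Set Implicit Arguments.
Unset Strict Implicit.
Unset Printing Implicit Defensive.

(** Occupied corners are counted in two ways. Each tableau has one more corner than inner corners
    ([corners_inner]), and deleting or adding an empty corner cell matches empty corners with inner
    corners ([sum_empty_corners]). Cancelling leaves as many occupied corners as tableaux
    ([sum_oc_tlt]). In size at least 2, an occupied corner has either a point to its left or a point
    above it ([corner_before]). Deleting its column, respectively its row, gives a tableau with one
    point less and a marked row ([sum_left_corners]), respectively a marked column
    ([sum_above_corners]). By [sum_points] a tableau of size [n.+1] has [n.+2] rows and columns in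
    all, so the second count is [n.+2] times the number of tableaux of size [n.+1] ([sum_oc_tltS]).
    Equating the counts gives the recursion of the factorial ([card_tlt]). *)

(** * Point sets of tree-like tableaux, up to transposition *)

Definition before (p : nat -> bool) (m : nat) : bool := [exists k : 'I_m, p k].

Lemma beforeP (p : nat -> bool) m : reflect (exists2 k, k < m & p k) (before p m).
Proof.
apply: (iffP existsP) => [[k pk] | [k km pk]]; first by exists k.
by exists (Ordinal km).
Qed.

Lemma eq_before (p q : nat -> bool) m : p =1 q -> before p m = before q m.
Proof. by move=> pq; apply: eq_existsb => k; apply: pq. Qed.

(** This makes each nonempty row or column contribute exactly 1 to a count of leftmost or topmost
    points. *)
Lemma sum_first (p : nat -> bool) m :
  (exists2 k, k < m & p k) -> \sum_(k < m) (p k && ~~ before p k) = 1.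
Proof.
case=> k0 k0m pk0.
have exp : exists k, p k by exists k0.
case: (ex_minnP exp) => k pk kmin.
have km : k < m by apply: leq_ltn_trans k0m; apply: kmin.
rewrite (bigD1 (Ordinal km)) //= pk big1 => [|l lk].
  suff /negPf-> : ~~ before p k by [].
  by apply/beforeP => -[l lk /kmin]; rewrite leqNgt lk.
apply/eqP; rewrite eqb0 negb_and negbK -implybE; apply/implyP => pl.
apply/beforeP; exists k => //.
by rewrite ltn_neqAle kmin // andbT; apply: contraNneq lk => kl; apply/eqP/val_inj.
Qed.

(* The part of the definition of tree-like tableaux that only involves the set *)
(* of points and the numbers of rows and columns, in a form that is invariant  *)
(* under transposition.                                                        *)
Definition tree_cond (P : nat -> nat -> bool) (h w : nat) : Prop :=
  [/\ P 0 0,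
      forall i j, P i j -> 0 < i + j -> before (P^~ j) i (+) before (P i) j,
      forall i, i < h -> exists j, P i j
    & forall j, j < w -> exists i, P i j].

Lemma tree_cond_tr (P : nat -> nat -> bool) h w :
  tree_cond P h w -> tree_cond (fun i j => P j i) w h.
Proof.
case=> P00 Pn Pr Pc; split=> // i j Pij ij_gt0.
by rewrite addbC; apply: Pn; rewrite // addnC.
Qed.

(* Every point other than the root is topmost in its column or leftmost in its *)
(* row, but not both; the root is both.                                        *)
Lemma sum_points (P : nat -> nat -> bool) h w :
    0 < h -> 0 < w -> tree_cond P h w ->
    (forall i j, P i j -> (i < h) && (j < w)) ->
  h + w = (\sum_(i < h) \sum_(j < w) P i j).+1.
Proof.
move=> h0 w0 [P00 Pn Pr Pc] Phw.
have rows : \sum_(i < h) \sum_(j < w) (P i j && ~~ before (P i) j) = h.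
  rewrite -[RHS]card_ord -sum1_card; apply: eq_bigr => i _.
  have [j Pij] := Pr i (ltn_ord i).
  by apply: (@sum_first (P i)); exists j => //; case/andP: (Phw _ _ Pij).
have cols : \sum_(i < h) \sum_(j < w) (P i j && ~~ before (P^~ j) i) = w.
  rewrite exchange_big -[RHS]card_ord -sum1_card; apply: eq_bigr => j _ /=.
  have [i Pij] := Pc j (ltn_ord j).
  by apply: (@sum_first (P^~ j)); exists i => //; case/andP: (Phw _ _ Pij).
have root : \sum_(i < h) \sum_(j < w) ((i + j == 0) : nat) = 1.
  rewrite (bigD1 (Ordinal h0)) //= (bigD1 (Ordinal w0)) //= !big1 ?addn0 //.
    move=> i; rewrite -val_eqE /= => i0; rewrite big1 // => j _.
    by rewrite addn_eq0 (negPf i0).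
  by move=> j; rewrite -val_eqE /= => j0; rewrite add0n (negPf j0).
apply: etrans (esym (congr2 addn rows cols)) _.
rewrite -addn1 -root -!big_split; apply: eq_bigr => i _ /=.
rewrite -!big_split; apply: eq_bigr => j _ /=.
have [Pij|nPij] := boolP (P i j); last first.
  by case: eqP => // /eqP; rewrite addn_eq0 => /andP[/eqP i0 /eqP j0];
     rewrite i0 j0 P00 in nPij.
case: posnP => [/eqP | /(Pn _ _ Pij)]; last by do 2!case: before.
rewrite addn_eq0 => /andP[/eqP-> /eqP->].
by case: beforeP => [[]|] //; case: beforeP => [[]|].
Qed.

(** * Inserting and deleting a column whose only point ends its row *)

Section Insertion.

Variables (P P' : nat -> nat -> bool) (h w k j : nat).
Hypothesis Pbump : forall i l, P i (bump j l) = P' i l.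
Hypothesis Pcol : forall i, P i j = (i == k).
Hypothesis Prow : forall l, P' k l -> l < j.
Hypothesis kh : k < h.
Hypothesis jw : j <= w.

Lemma before_above_bump i l : before (P^~ (bump j l)) i = before (P'^~ l) i.
Proof. by apply: eq_before => x; apply: Pbump. Qed.

(** The only point of column [j] is in row [k], to the right of all other points there, so it is
    never to the left of an old point. *)
Lemma before_left_bump i l :
  P' i l -> before (P i) (bump j l) = before (P' i) l.
Proof.
move=> Pil; apply/beforeP/beforeP => -[x xl Px]; last first.
  by exists (bump j x); rewrite ?Pbump //; rewrite /bump; lia.
have [xj | xj] := eqVneq x j.
  move: Px Pil xl; rewrite xj Pcol => /eqP-> /Prow; rewrite /bump; lia.
by exists (unbump j x); [move: xl xj; rewrite /bump /unbump; lia
                        | rewrite -Pbump unbumpK].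
Qed.

(** Row [k] already has a point, necessarily left of [j], so the new point has one to its left;
    being alone in its column, it has none above. *)
Lemma tree_cond_insert :
  tree_cond P' h w -> tree_cond P h w.+1 /\ before (P k) j.
Proof.
case=> P00 Pn Pr Pc.
have leftk : before (P k) j.
  have [l Pl] := Pr k kh; have lj := Prow Pl.
  by apply/beforeP; exists l; rewrite // -Pbump /bump leqNgt lj in Pl *.
have j0 : 0 < j by case/beforeP: leftk => x; case: j.
split=> //; split.
- by rewrite -Pbump /bump leqNgt j0 in P00.
- move=> i x; have [-> | xj] := eqVneq x j.
    rewrite Pcol => /eqP-> _; rewrite leftk addbT.
    by apply/beforeP => -[y yk]; rewrite Pcol => /eqP yk'; rewrite yk' ltnn in yk.
  rewrite -(unbumpK xj) Pbump => Px x0.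
  rewrite before_above_bump before_left_bump //; apply: Pn => //.
  by move: x0 xj; rewrite /bump /unbump; lia.
- by move=> i /Pr[l Pl]; exists (bump j l); rewrite Pbump.
move=> x xw; have [-> | xj] := eqVneq x j; first by exists k; rewrite Pcol.
have [|i Pi] := Pc (unbump j x); first by move: xw xj; rewrite /unbump; lia.
by exists i; rewrite -(unbumpK xj) Pbump.
Qed.

(** The point to the left of the deleted one keeps row [k] nonempty. *)
Lemma tree_cond_delete :
  tree_cond P h w.+1 -> before (P k) j -> tree_cond P' h w.
Proof.
case=> P00 Pn Pr Pc leftk.
have j0 : 0 < j by case/beforeP: leftk => x; case: j.
split.
- by rewrite -Pbump /bump leqNgt j0.
- move=> i l Pil il; rewrite -before_above_bump -before_left_bump //.
  by apply: Pn; rewrite ?Pbump //; move: il; rewrite /bump; lia.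
- move=> i /Pr[x Px]; have [xj | xj] := eqVneq x j; last first.
    by exists (unbump j x); rewrite -Pbump unbumpK.
  move: Px; rewrite xj Pcol => /eqP->; case/beforeP: leftk => y yj Py.
  by exists y; rewrite -Pbump /bump leqNgt yj.
move=> l lw; have [|i Pi] := Pc (bump j l); first by rewrite /bump; lia.
by exists i; rewrite -Pbump.
Qed.

End Insertion.

(** * Tree-like tableaux of given size, in a form suited to surgery *)

Lemma point_cell (T : filling) i j :
  is_point T i j -> (i < size T) && (j < row_length T i).
Proof.
move=> Pij; apply/andP; split; rewrite ltnNge; apply: contraTN Pij => le.
  by rewrite /is_point [nth [::] T i]nth_default // nth_nil.
by rewrite /is_point [nth false _ j]nth_default.
Qed.

Definition row_sorted (T : filling) : Prop :=
  forall i, row_length T i.+1 <= row_length T i.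

Lemma row_length_homo T i k :
  row_sorted T -> i <= k -> row_length T k <= row_length T i.
Proof.
move=> sT /subnK <-; elim: (k - i) => //= d IH.
by rewrite addSn; apply: leq_trans IH.
Qed.

Lemma tree_likeP T :
  tree_like T <->
  row_sorted T /\ tree_cond (is_point T) (size T) (row_length T 0).
Proof.
split=> [/and5P[yT rT nT rowT colT] | [sT [P00 Pn Pr Pc]]].
  split.
    case/andP: yT => /(sortedP 0); rewrite size_map => srt _ i.
    have [iT|iT] := ltnP i.+1 (size T).
      by have := srt i iT; rewrite /= !(nth_map [::]) // ltnW.
    by rewrite /row_length nth_default.
  split=> // [i j Pij ij|i iT|j jT].
  - case/andP: (point_cell Pij) => iT jT.
    move/forallP/(_ (Ordinal iT))/forallP/(_ (Ordinal jT)): nT => /= /implyP.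
    apply; rewrite Pij xpair_eqE -addn_eq0 -lt0n; exact: ij.
  - move/forallP/(_ (Ordinal iT))/existsP: rowT => -[j Pj]; by exists j.
  move/forallP/(_ (Ordinal jT))/existsP: colT => -[i Pi]; by exists i.
apply/and5P; split=> //.
- apply/andP; split.
    apply/(sortedP 0) => i; rewrite size_map => iT.
    by rewrite /= !(nth_map [::]) ?sT // ltnW.
  apply/mapP => -[r /(nthP [::])[i iT <-]] r0; have [j /point_cell] := Pr i iT.
  by rewrite /row_length -r0 andbF.
- apply/forallP => i; apply/forallP => j; apply/implyP => /andP[Pij ij].
  by apply: Pn => //; rewrite lt0n addn_eq0 -xpair_eqE.
- apply/forallP => i; have [j Pj] := Pr i (ltn_ord i); apply/existsP.
  by case/andP: (point_cell Pj) => _ jT; exists (Ordinal jT).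
apply/forallP => j; have [i Pi] := Pc j (ltn_ord j); apply/existsP.
by case/andP: (point_cell Pi) => iT _; exists (Ordinal iT).
Qed.

(** The number of points is replaced by the number of rows and columns, which is easy to follow when
    cells, rows or columns are added; [tlt_of_sizeP] shows that this is equivalent. *)
Definition tlt_of_size (n : nat) (T : filling) : Prop :=
  [/\ row_sorted T, tree_cond (is_point T) (size T) (row_length T 0)
    & size T + row_length T 0 = n.+1].

Lemma size_tree_like T :
  tree_like T -> size T + row_length T 0 = (num_points T).+1.
Proof.
move=> tT; have /tree_likeP[sT cT] := tT.
have /andP[yT _] := tT.
have /andP[T0 w0] : (0 < size T) && (0 < row_length T 0).
  by case: cT => /point_cell.
have -> : num_points T =
    \sum_(i < size T) \sum_(j < row_length T 0) is_point T i j.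
  apply: eq_bigr => i _.
  rewrite (big_ord_widen _ (fun j => is_point T i j : nat) (row_length_le i yT)).
  rewrite big_mkcond; apply: eq_bigr => j _; case: ltnP => // leTj.
  by rewrite /is_point nth_default.
apply: sum_points => // i j /point_cell/andP[-> jT].
exact: leq_trans jT (row_length_homo sT (leq0n i)).
Qed.

Lemma tlt_of_sizeP n T :
  tlt_of_size n T <-> tree_like T && (num_points T == n).
Proof.
split=> [[sT cT szT] | /andP[tT /eqP <-]].
  have tT : tree_like T by apply/tree_likeP.
  by rewrite tT /= -eqSS -size_tree_like ?szT.
by have /tree_likeP[sT cT] := tT; split=> //; apply: size_tree_like.
Qed.

Lemma tlt_size_le n T : tlt_of_size n T -> size T <= n.
Proof.
case=> _ [/point_cell/andP[_ r0] _ _ _] szT.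
by rewrite -ltnS -szT -addn1 leq_add2l.
Qed.

Lemma tlt_width_le n T : tlt_of_size n T -> row_length T 0 <= n.
Proof.
case=> _ [/point_cell/andP[T0 _] _ _ _] szT.
by rewrite -ltnS -szT -add1n leq_add2r.
Qed.

Lemma tlt_of_sizeT n (T : tlt n) : tlt_of_size n T.
Proof. exact/tlt_of_sizeP/tlt_prop. Qed.

(** * Bijections between marked tableaux *)

(** Both sums count tableaux with a marked index, and [f] is injective on the selected pairs because
    [g] undoes it. The maps act on raw fillings, so surgeries carry no proofs. *)
Lemma leq_sum_tlt n m (p q : filling -> nat -> bool)
    (f g : filling * nat -> filling * nat) :
    (forall T i, tlt_of_size n T -> i < n -> p T i ->
       [/\ tlt_of_size m (f (T, i)).1, (f (T, i)).2 < m,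
           q (f (T, i)).1 (f (T, i)).2 & g (f (T, i)) = (T, i)]) ->
  \sum_(T : tlt n) \sum_(i < n) p T i <= \sum_(T : tlt m) \sum_(i < m) q T i.
Proof.
pose s a (r : filling -> nat -> bool) :=
  [seq x <- [seq (val T, i) | T <- enum {: tlt a}, i <- iota 0 a] | r x.1 x.2].
have sizes a (r : filling -> nat -> bool) :
    \sum_(T : tlt a) \sum_(i < a) r T i = size (s a r).
  rewrite size_filter count_flatten -map_comp sumnE big_map big_enum /=.
  apply: eq_bigr => T _; rewrite count_map -sumn_count sumnE big_map.
  by rewrite -(big_mkord xpredT (fun i => r T i : nat)) /index_iota subn0.
have mems a (r : filling -> nat -> bool) x :
    reflect [/\ tlt_of_size a x.1, x.2 < a & r x.1 x.2] (x \in s a r).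
  rewrite mem_filter; apply: (iffP andP) => [[rx /allpairsP[[U l] [_ il xE]]]|].
    move: rx il; rewrite mem_iota xE /= => rx il; split=> //.
    exact: tlt_of_sizeT.
  case: x => T i /= [/tlt_of_sizeP tT ia rT]; split=> //.
  apply/allpairsP; exists (TLT tT, i).
  by split; rewrite ?mem_enum ?mem_iota.
move=> fg; rewrite !sizes -(size_map f); apply: uniq_leq_size.
  rewrite map_inj_in_uniq ?filter_uniq ?allpairs_uniq ?enum_uniq ?iota_uniq //.
    by move=> [U i] [V j] _ _ /= [/val_inj-> ->].
  apply: (can_in_inj (g := g)) => -[T i] /mems[/= tT iT pT].
  by case: (fg T i tT iT pT).
move=> _ /mapP[[T i] /mems[/= tT iT pT] ->]; apply/mems.
by case: (fg T i tT iT pT).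
Qed.

Lemma eq_sum_tlt n m (p q : filling -> nat -> bool)
    (f g : filling * nat -> filling * nat) :
    (forall T i, tlt_of_size n T -> i < n -> p T i ->
       [/\ tlt_of_size m (f (T, i)).1, (f (T, i)).2 < m,
           q (f (T, i)).1 (f (T, i)).2 & g (f (T, i)) = (T, i)]) ->
    (forall T i, tlt_of_size m T -> i < m -> q T i ->
       [/\ tlt_of_size n (g (T, i)).1, (g (T, i)).2 < n,
           p (g (T, i)).1 (g (T, i)).2 & f (g (T, i)) = (T, i)]) ->
  \sum_(T : tlt n) \sum_(i < n) p T i = \sum_(T : tlt m) \sum_(i < m) q T i.
Proof.
move=> fg gf; apply/eqP; rewrite eqn_leq.
by rewrite (leq_sum_tlt fg) (leq_sum_tlt gf).
Qed.

(** * Corners, inner corners and empty corners *)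

Definition last_col (T : filling) (i : nat) : nat := (row_length T i).-1.

Definition corner_row (T : filling) (i : nat) : bool :=
  row_length T i.+1 < row_length T i.

Definition inner_row (T : filling) (i : nat) : bool :=
  (0 < i < size T) && (row_length T i < row_length T i.-1).

Definition last_point (T : filling) (i : nat) : bool :=
  is_point T i (last_col T i).

Lemma sum_corners_row (T : filling) i :
  \sum_(j < row_length T i) (is_corner T i j && is_point T i j) =
  (corner_row T i && last_point T i).
Proof.
rewrite /corner_row /last_point /last_col /is_corner /is_cell.
case: (row_length T i) => [|r]; first by rewrite big_ord0 ltn0.
rewrite big_ord_recr big1 /= => [|j _].
  by rewrite !ltnS leqnn ltnn -leqNgt andbT.
by rewrite !ltnS ltn_ord !andbF.
Qed.

Lemma ocE n (T : filling) :
  size T <= n -> oc T = \sum_(i < n) (corner_row T i && last_point T i).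
Proof.
move=> Tn.
have -> : oc T = \sum_(i < size T) (corner_row T i && last_point T i).
  by apply: eq_bigr => i _; apply: sum_corners_row.
rewrite (big_ord_widen n (fun i => (corner_row T i && last_point T i) : nat)) //.
rewrite big_mkcond; apply: eq_bigr => i _; case: ltnP => // Ti.
by rewrite /corner_row {2}/row_length nth_default.
Qed.

(** Row [i] ends in a corner exactly when row [i.+1] is shorter, that is, when row [i.+1] has an
    inner corner or [i] is the last row. *)
Lemma corners_inner n (T : filling) :
    row_sorted T -> 0 < size T <= n -> 0 < row_length T (size T).-1 ->
  \sum_(i < n) corner_row T i = (\sum_(i < n) inner_row T i).+1.
Proof.
case E: (size T) => [|s] //= sT sn r0.
have rs : row_length T s.+1 = 0 by rewrite /row_length nth_default ?E.
have widen (p : nat -> bool) : (forall i, s < i -> p i = false) ->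
    \sum_(i < n) p i = \sum_(i < s.+1) p i.
  move=> pF; rewrite [RHS](big_ord_widen n (fun i => p i : nat)) // [RHS]big_mkcond.
  by apply: eq_bigr => i _; case: ltnP => // /pF->.
rewrite (widen (corner_row T)) => [|i si]; last first.
  by rewrite /corner_row {2}/row_length nth_default ?E.
rewrite (widen (inner_row T)) => [|i si]; last first.
  by rewrite /inner_row E [i < _]ltnNge si andbF.
(* Split off the last row, always a corner row, and row 0, never an inner row; the remaining terms
   agree after a shift by one. *)
rewrite big_ord_recr big_ord_recl /= {2}/corner_row rs r0 addn1.
congr _.+1; apply: eq_bigr => i _.
by rewrite /inner_row /bump /= add1n E ltnS ltn_ord.
Qed.

Lemma corner_row_size T i : corner_row T i -> i < size T.
Proof.
apply: contraLR; rewrite -leqNgt => Ti.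
by rewrite /corner_row {2}/row_length nth_default ?ltn0.
Qed.

Lemma corner_row_last T i :
  corner_row T i -> row_length T i = (last_col T i).+1.
Proof. by rewrite /corner_row /last_col; case: (row_length T i). Qed.

Lemma corner_row_below T i k :
  row_sorted T -> corner_row T i -> i < k -> row_length T k <= last_col T i.
Proof.
move=> sT cT ik; apply: leq_trans (row_length_homo sT ik) _.
by move: (cT); rewrite /corner_row (corner_row_last cT).
Qed.

Lemma eq_tree_cond (P Q : nat -> nat -> bool) h w :
  (forall i j, P i j = Q i j) -> tree_cond P h w -> tree_cond Q h w.
Proof.
move=> PQ [P00 Pn Pr Pc]; split=> [|i j|i /Pr[j]|j /Pc[i]].
- by rewrite -PQ.
- rewrite -PQ => Pij /(Pn _ _ Pij).
  by rewrite (eq_before _ (fun i => PQ i j)) (eq_before _ (PQ i)).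
- by exists j; rewrite -PQ.
by exists i; rewrite -PQ.
Qed.

Lemma row_length_set_nth (T : filling) i r k :
  row_length (set_nth [::] T i r) k = if k == i then size r else row_length T k.
Proof. by rewrite /row_length nth_set_nth /=; case: eqP. Qed.

Lemma size_set_nth_lt (T : filling) i r :
  i < size T -> size (set_nth [::] T i r) = size T.
Proof. by move=> iT; rewrite size_set_nth; apply/maxn_idPr. Qed.

Lemma is_point_set_nth (T : filling) i r k l :
    (forall l, nth false r l = is_point T i l) ->
  is_point (set_nth [::] T i r) k l = is_point T k l.
Proof. by move=> rE; rewrite /is_point nth_set_nth /=; case: eqP => // ->. Qed.

(** Changing a row below the first by empty cells only keeps the point set, the number of rows and
    the width. *)
Lemma tlt_of_size_set_nth n (T : filling) i r :
    tlt_of_size n T -> 0 < i < size T ->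
    (forall l, nth false r l = is_point T i l) ->
    row_length T i.+1 <= size r <= row_length T i.-1 ->
  tlt_of_size n (set_nth [::] T i r).
Proof.
move=> [sT cT szT] /andP[i0 iT] rE /andP[r1 r2]; split.
- move=> k; rewrite !row_length_set_nth.
  have [ki|ki] := eqVneq k.+1 i; first by rewrite -ki in r2 *; case: eqP => //; lia.
  by case: (eqVneq k i) => // ->.
- rewrite size_set_nth_lt // row_length_set_nth (ltn_eqF i0).
  by apply: eq_tree_cond cT => k l; rewrite is_point_set_nth.
by rewrite size_set_nth_lt // row_length_set_nth (ltn_eqF i0).
Qed.

Definition remove_cell (x : filling * nat) : filling * nat :=
  (set_nth [::] x.1 x.2 (take (last_col x.1 x.2) (nth [::] x.1 x.2)), x.2).

Definition add_cell (x : filling * nat) : filling * nat :=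
  (set_nth [::] x.1 x.2 (rcons (nth [::] x.1 x.2) false), x.2).

Lemma set_nth_set_nth_id (T : filling) i r :
  i < size T -> set_nth [::] (set_nth [::] T i r) i (nth [::] T i) = T.
Proof.
move=> iT; apply: (@eq_from_nth _ [::]) => [|k _].
  by rewrite !size_set_nth_lt ?size_set_nth_lt.
by rewrite !nth_set_nth /= !nth_set_nth /=; case: eqP => // ->.
Qed.

Lemma sum_empty_corners n :
  \sum_(T : tlt n) \sum_(i < n) (corner_row T i && ~~ last_point T i) =
  \sum_(T : tlt n) \sum_(i < n) inner_row T i.
Proof.
apply: (@eq_sum_tlt n n (fun T i => corner_row T i && ~~ last_point T i)
  inner_row remove_cell add_cell) => T i tT i_n.
  case/andP=> cTi nP; have iT := corner_row_size cTi; have rT := corner_row_last cTi.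
  have [sT [_ _ _ Pc] _] := tT.
  (* Lower rows do not reach a corner of the first row, so if that corner were empty its whole
     column would be. *)
  have i0 : 0 < i.
    rewrite lt0n; apply: contraNneq nP => i0; rewrite i0 in cTi rT *.
    have [|k Pk] := Pc (last_col T 0); first by rewrite rT.
    have [k0|k0] := posnP k; first by rewrite -k0 in Pk *; rewrite k0 in Pk *.
    have /andP[_] := point_cell Pk.
    by rewrite ltnNge (corner_row_below sT cTi).
  rewrite /remove_cell /=; set r := take _ (nth [::] T i).
  have rE : rcons r false = nth [::] T i.
    rewrite -[RHS]take_size [size _]rT (take_nth false) ?[size _]rT //; congr rcons.
    by move: nP; rewrite /last_point /is_point => /negPf.
  have sr : size r = last_col T i by rewrite size_take [size _]rT ltnSn.
  split=> //=.
  - apply: tlt_of_size_set_nth => //; first by rewrite i0.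
      move=> l; rewrite /is_point -rE nth_rcons; case: ltngtP => // lr.
        by rewrite nth_default // ltnW.
      by rewrite nth_default ?lr.
    rewrite sr (corner_row_below sT cTi) //=.
    have := sT i.-1; rewrite prednK // rT; exact: ltnW.
  - rewrite /inner_row size_set_nth_lt // i0 iT /= !row_length_set_nth eqxx.
    rewrite sr (_ : i.-1 == i = false); last by lia.
    by have := sT i.-1; rewrite prednK // rT.
  rewrite /add_cell /= nth_set_nth /= eqxx -/r rE.
  by rewrite set_nth_set_nth_id.
case/andP=> /andP[i0 iT] ri; have [sT _ _] := tT.
rewrite /add_cell /=; set r := nth [::] T i; set T' := set_nth _ _ _ _.
have rE : last_col T' i = size r.
  by rewrite /last_col row_length_set_nth eqxx size_rcons.
split=> //=.
- apply: tlt_of_size_set_nth => //; first by rewrite i0.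
    move=> l; rewrite nth_rcons -/r /is_point -/r; case: ltngtP => // lr.
      by rewrite nth_default // ltnW.
    by rewrite nth_default ?lr.
  by rewrite size_rcons ri andbT ltnW // ltnS; apply: sT.
- rewrite /last_point rE /corner_row !row_length_set_nth eqxx size_rcons.
  rewrite (_ : i.+1 == i = false) ?ltnS ?sT /=; last by lia.
  rewrite /is_point nth_set_nth /= eqxx nth_rcons ltnn eqxx; by [].
rewrite /remove_cell rE /= nth_set_nth /= eqxx -/r -cats1 take_size_cat //.
by rewrite set_nth_set_nth_id.
Qed.

(** * Deleting and inserting one entry of a sequence *)

Section SeqSurgery.

Variables (A : Type) (x0 : A).
Implicit Types (s : seq A) (j l : nat).

Definition delete_at j s : seq A := take j s ++ drop j.+1 s.

Definition insert_at j a s : seq A := take j s ++ a :: drop j s.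

Lemma size_delete_at j s : size (delete_at j s) = size s - (j < size s).
Proof. by rewrite size_cat size_take size_drop; case: ltnP; lia. Qed.

Lemma size_insert_at j a s : size (insert_at j a s) = (size s).+1.
Proof. by rewrite size_cat /= size_take size_drop; case: ltnP; lia. Qed.

Lemma nth_delete_at j s l : nth x0 (delete_at j s) l = nth x0 s (bump j l).
Proof.
rewrite /bump nth_cat size_take nth_drop; have [js|sj] := ltnP j (size s).
  have [lj|jl] := ltnP l j; first by rewrite nth_take.
  by congr nth; lia.
rewrite take_oversize //; have [ls|sl] := ltnP l (size s).
  by rewrite leqNgt (leq_trans ls sj).
by rewrite !nth_default //; lia.
Qed.

Lemma nth_insert_at_bump j a s l :
  j <= size s -> nth x0 (insert_at j a s) (bump j l) = nth x0 s l.
Proof.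
move=> js; rewrite /bump nth_cat size_takel //.
have [lj|jl] := ltnP l j; first by rewrite add0n lj nth_take.
by rewrite ltnNge leqW //= subSn //= nth_drop subnKC.
Qed.

Lemma nth_insert_at j a s : j <= size s -> nth x0 (insert_at j a s) j = a.
Proof. by move=> js; rewrite nth_cat size_takel // ltnn subnn. Qed.

Lemma insert_atK j a s : j <= size s -> delete_at j (insert_at j a s) = s.
Proof.
move=> js; rewrite /delete_at /insert_at take_size_cat ?size_takel //.
by rewrite drop_cat size_takel // ltnNge leqnSn /= subSnn /= drop0 cat_take_drop.
Qed.

Lemma delete_atK j s :
  j < size s -> insert_at j (nth x0 s j) (delete_at j s) = s.
Proof.
move=> js; rewrite /delete_at /insert_at take_size_cat ?size_takel ?(ltnW js) //.
by rewrite drop_size_cat ?size_takel ?(ltnW js) // -drop_nth // cat_take_drop.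
Qed.

End SeqSurgery.

(** * Occupied corners with a point to the left, and marked rows *)

(** A corner at the root would make the diagram a single cell, which the size excludes. *)
Lemma corner_before n T i :
    tlt_of_size n.+2 T -> corner_row T i -> last_point T i ->
  before ((is_point T)^~ (last_col T i)) i (+) before (is_point T i) (last_col T i).
Proof.
move=> [sT [P00 Pn Pr Pc] szT] ci Pi; apply: Pn => //.
rewrite lt0n; apply/negP; rewrite addn_eq0 => /andP[/eqP i0 /eqP l0].
rewrite i0 in ci l0; have r0 := corner_row_last ci; rewrite l0 in r0.
have T1 : 1 < size T by move: szT; rewrite r0; lia.
have [j /point_cell/andP[_]] := Pr _ T1.
by move: ci; rewrite /corner_row r0 ltnS leqn0 => /eqP->.
Qed.

(** Rows too short to meet the column are left unchanged by [delete_at]. *)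
Definition delete_column (x : filling * nat) : filling * nat :=
  (map (delete_at (last_col x.1 x.2)) x.1, x.2).

(** The new column stands just past the end of the marked row and reaches down to that row, where
    its only point becomes a corner. *)
Definition insert_column (x : filling * nat) : filling * nat :=
  let j := row_length x.1 x.2 in
  (mkseq (fun i => let r := nth [::] x.1 i in
                   if i <= x.2 then insert_at j (i == x.2) r else r) (size x.1),
   x.2).

Lemma nth_delete_column T i k :
  nth [::] (delete_column (T, i)).1 k = delete_at (last_col T i) (nth [::] T k).
Proof.
have [kT|Tk] := ltnP k (size T); first by rewrite (nth_map [::]).
by rewrite !nth_default ?size_map.
Qed.

Lemma nth_insert_column T k i :
    k < size T ->
  nth [::] (insert_column (T, k)).1 i =
  if i <= k then insert_at (row_length T k) (i == k) (nth [::] T i)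
  else nth [::] T i.
Proof.
move=> kT; have [iT|Ti] := ltnP i (size T); first by rewrite nth_mkseq.
by rewrite leqNgt (leq_trans kT Ti) /= !nth_default ?size_mkseq.
Qed.

Definition left_corner (T : filling) (i : nat) : bool :=
  [&& corner_row T i, last_point T i & before (is_point T i) (last_col T i)].

Definition above_corner (T : filling) (i : nat) : bool :=
  [&& corner_row T i, last_point T i
    & before ((is_point T)^~ (last_col T i)) i].

Lemma sum_left_corners n :
  \sum_(T : tlt n.+2) \sum_(i < n.+2) left_corner T i =
  \sum_(T : tlt n.+1) \sum_(k < n.+1) (k < size (T : filling)).
Proof.
apply: (@eq_sum_tlt n.+2 n.+1 left_corner (fun T k => k < size T)
  delete_column insert_column) => T k tT kn.
  case/and3P=> ck Pk lk; have kT := corner_row_size ck.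
  have rk := corner_row_last ck; have ab := corner_before tT ck Pk.
  have [sT cT szT] := tT.
  set j := last_col T k in lk rk ab *; set T' := (delete_column (T, k)).1.
  have szT' : size T' = size T by rewrite size_map.
  have rT' i : row_length T' i = row_length T i - (j < row_length T i).
    by rewrite /row_length nth_delete_column size_delete_at.
  have Pb i l : is_point T i (bump j l) = is_point T' i l.
    by rewrite /is_point nth_delete_column nth_delete_at.
  (* The point to the left of the corner rules out points above it, and rows below do not reach
     column [j]. *)
  have Pcol i : is_point T i j = (i == k).
    have [ik|ki|->] := ltngtP i k; last exact: Pk.
      apply/negP => Pi; suff ab1 : before ((is_point T)^~ j) k by rewrite ab1 lk in ab.
      by apply/beforeP; exists i.
    apply/negP => /point_cell/andP[_].
    by rewrite ltnNge (corner_row_below sT ck).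
  have r0 : j < row_length T 0 by rewrite -rk; apply: row_length_homo.
  have tT' : tlt_of_size n.+1 T'.
    split=> [i||].
    - by rewrite !rT'; have := sT i; lia.
    - rewrite szT' rT' r0; apply: (tree_cond_delete Pb Pcol _ kT _ _ lk).
      + by move=> l; rewrite -Pb => /point_cell/andP[_]; rewrite rk /bump; lia.
      + by rewrite subn1; lia.
      by rewrite subn1 prednK //; apply: leq_trans r0.
    by rewrite szT' rT' r0; lia.
  split=> //=; rewrite ?size_map //.
    by apply: leq_trans (tlt_size_le tT'); rewrite szT'.
  rewrite -[delete_column _]/(T', k) /insert_column /= szT'; congr pair.
  apply: (@eq_from_nth _ [::]) => [|i]; rewrite size_mkseq // => iT.
  rewrite nth_mkseq // rT' rk ltnSn subn1 /= nth_delete_column -/j.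
  case: leqP => [ik|ki].
    rewrite -Pcol /is_point delete_atK //.
    by rewrite -/(row_length T i) -rk row_length_homo.
  rewrite /delete_at take_oversize; last exact: corner_row_below.
  by rewrite drop_oversize ?cats0 // leqW //; apply: corner_row_below.
move=> kT; have [sT cT szT] := tT.
set j := row_length T k; set T' := (insert_column (T, k)).1.
have szT' : size T' = size T by rewrite size_mkseq.
have rT' i : row_length T' i = row_length T i + (i <= k).
  rewrite /row_length nth_insert_column //; case: leqP; rewrite ?addn0 //.
  by rewrite size_insert_at addn1.
have jr i : i <= k -> j <= size (nth [::] T i) by exact: row_length_homo.
have Pb i l : is_point T' i (bump j l) = is_point T i l.
  rewrite /is_point nth_insert_column //; case: leqP => [ik|ki].
    by rewrite nth_insert_at_bump ?jr.
  have rj : size (nth [::] T i) <= j by exact: row_length_homo (ltnW ki).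
  rewrite /bump; case: leqP => // jl; have rl := leq_trans rj jl.
  by rewrite !(nth_default false) ?leqW.
have Pcol i : is_point T' i j = (i == k).
  rewrite /is_point nth_insert_column //; case: leqP => [ik|ki].
    by rewrite nth_insert_at ?jr.
  rewrite nth_default ?gtn_eqF //; exact: row_length_homo (ltnW ki).
have Prow l : is_point T k l -> l < j by case/point_cell/andP.
have jw : j <= row_length T 0 by exact: row_length_homo.
have [cT' lk] := tree_cond_insert Pb Pcol Prow kT jw cT.
have rk : row_length T' k = j.+1 by rewrite rT' leqnn addn1.
have lck : last_col T' k = j by rewrite /last_col rk.
have tT' : tlt_of_size n.+2 T'.
  split=> [i||].
  - by rewrite !rT'; have := sT i; lia.
  - by rewrite szT' rT' addn1.
  by rewrite szT' rT' addn1 addnS szT.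
rewrite -[insert_column _]/(T', k).
split=> //=; first exact: leq_trans kn _.
  rewrite /left_corner /last_point lck Pcol eqxx lk /corner_row rk rT'.
  by rewrite ltnn addn0 ltnS sT.
rewrite /delete_column /= lck; congr pair.
apply: (@eq_from_nth _ [::]) => [|i]; rewrite size_map // szT' => iT.
rewrite (nth_map [::]) ?szT' // nth_insert_column // -/j.
case: leqP => [ik|ki]; first by rewrite insert_atK ?jr.
have rj : size (nth [::] T i) <= j by exact: row_length_homo (ltnW ki).
by rewrite /delete_at take_oversize // drop_oversize ?cats0 // leqW.
Qed.

(** * Occupied corners with a point above, and marked columns *)

Definition column_height (T : filling) (c : nat) : nat :=
  find (fun r : seq bool => size r <= c) T.

Lemma lt_column_height T c k :
  row_sorted T -> (k < column_height T c) = (c < row_length T k).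
Proof.
move=> sT; have [kh|hk] := ltnP k (column_height T c).
  by have := before_find [::] kh; rewrite /row_length ltnNge => ->.
apply/esym/negbTE; rewrite -leqNgt; apply: leq_trans (row_length_homo sT hk) _.
have [hT|Th] := ltnP (column_height T c) (size T).
  apply: (@nth_find _ [::] (fun r : seq bool => size r <= c)).
  by rewrite has_find.
by rewrite /row_length nth_default.
Qed.

Lemma column_height_eq T c h :
    row_sorted T -> (forall k, (k < h) = (c < row_length T k)) ->
  column_height T c = h.
Proof.
move=> sT hE; have E k : (k < column_height T c) = (k < h).
  by rewrite lt_column_height // hE.
apply/eqP; rewrite eqn_leq leqNgt E ltnn /=.
by rewrite leqNgt -E ltnn.
Qed.

Lemma column_height_size T c : column_height T c <= size T.
Proof. exact: find_size. Qed.

Definition delete_row (x : filling * nat) : filling * nat :=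
  (delete_at x.2 x.1, last_col x.1 x.2).

(** The new row goes directly below the marked column and ends, in that column, with its only
    point. *)
Definition insert_row (x : filling * nat) : filling * nat :=
  (insert_at (column_height x.1 x.2) (rcons (nseq x.2 false) true) x.1,
   column_height x.1 x.2).

Lemma sum_above_corners n :
  \sum_(T : tlt n.+2) \sum_(i < n.+2) above_corner T i =
  \sum_(T : tlt n.+1) \sum_(c < n.+1) (c < row_length T 0).
Proof.
apply: (@eq_sum_tlt n.+2 n.+1 above_corner (fun T c => c < row_length T 0)
  delete_row insert_row) => T k tT kn.
  case/and3P=> ck Pk ak; have kT := corner_row_size ck.
  have rk := corner_row_last ck; have ab := corner_before tT ck Pk.
  have [sT cT szT] := tT.
  rewrite /delete_row /=; set c := last_col T k in rk ak ab *; set T' := delete_at k T.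
  have szT' : size T' = (size T).-1 by rewrite size_delete_at kT subn1.
  have rT' i : row_length T' i = row_length T (bump k i).
    by rewrite /row_length nth_delete_at.
  have Pb l i : is_point T (bump k i) l = is_point T' i l.
    by rewrite /is_point nth_delete_at.
  have nl l : l < c -> is_point T k l = false.
    move=> lc; apply/negP => Pl; suff lk : before (is_point T k) c by rewrite ak lk in ab.
    by apply/beforeP; exists l.
  have Prow l : is_point T k l = (l == c).
    have [lc|cl|->] := ltngtP l c; [exact: nl | | exact: Pk].
    by apply/negP => /point_cell/andP[_]; rewrite rk ltnNge cl.
  (* After the deletion, column [c] has height exactly [k]; this is how [insert_row] recovers the
     place of the row. *)
  have hc i : (i < k) = (c < row_length T' i).
    rewrite rT' /bump; have [ki|ik] := leqP k i; last first.
      by rewrite -rk row_length_homo // ltnW.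
    by rewrite ltnNge (corner_row_below sT ck).
  have k0 : 0 < k by case/beforeP: ak => x; case: (k).
  have r0 : row_length T' 0 = row_length T 0 by rewrite rT' /bump leqNgt k0.
  have c0 : c < row_length T 0 by rewrite -r0 -hc.
  have sT' : row_sorted T'.
    by move=> i; rewrite !rT'; apply: row_length_homo => //; rewrite /bump; lia.
  have tT' : tlt_of_size n.+1 T'.
    split=> //; last by rewrite szT' r0; lia.
    apply: tree_cond_tr.
    (* The column lemma is applied to the transposed point set. *)
    apply: (@tree_cond_delete (fun l i => is_point T i l) _ _ _ c k) => //.
    - by move=> i /point_cell/andP[_]; rewrite -hc.
    - by rewrite r0.
    - by rewrite szT'; lia.
    by rewrite szT' r0 prednK ?(leq_ltn_trans _ kT) //; apply: tree_cond_tr.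
  split=> //=.
  - by apply: leq_trans (tlt_width_le tT'); rewrite r0.
  - by rewrite r0.
  rewrite /insert_row /= (column_height_eq sT' hc); congr pair.
  rewrite -[RHS](delete_atK [::] kT); congr insert_at.
  apply: (@eq_from_nth _ false); rewrite size_rcons size_nseq ?rk //= => l lc.
  rewrite -/(is_point T k l) Prow nth_rcons size_nseq nth_nseq.
  by case: ltngtP => //; rewrite ltnNge -ltnS lc.
move=> k0; have [sT cT szT] := tT.
rewrite /insert_row /=; set h := column_height T k.
set T' := insert_at h _ T.
have hT : h <= size T by exact: column_height_size.
have hk i : (i < h) = (k < row_length T i) by exact: lt_column_height.
have szT' : size T' = (size T).+1 by rewrite size_insert_at.
have rb i : row_length T' (bump h i) = row_length T i.
  by rewrite /row_length nth_insert_at_bump.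
have rh : row_length T' h = k.+1.
  by rewrite /row_length nth_insert_at // size_rcons size_nseq.
have Pb l i : is_point T' (bump h i) l = is_point T i l.
  by rewrite /is_point nth_insert_at_bump.
have Prow l : is_point T' h l = (l == k).
  rewrite /is_point nth_insert_at // nth_rcons size_nseq nth_nseq.
  by case: ltngtP.
have h0 : 0 < h by rewrite hk.
have r0 : row_length T' 0 = row_length T 0.
  by rewrite -rb /bump leqNgt h0.
have rS : row_length T' h.+1 = row_length T h by rewrite -rb /bump leqnn.
have Pcol i : is_point T i k -> i < h by rewrite hk => /point_cell/andP[].
have [ctT ah] := @tree_cond_insert (fun l i => is_point T' i l)
  (fun l i => is_point T i l) _ _ k h Pb Prow Pcol k0 hT (tree_cond_tr cT).
have sT' : row_sorted T'.
  move=> i; have [ih|hi|->] := ltngtP i h.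
  - have ri := rb i; rewrite /bump leqNgt ih add0n in ri; rewrite ri.
    have [->|ih'] := eqVneq i.+1 h; first by rewrite rh -hk.
    have := rb i.+1; rewrite /bump leqNgt ltn_neqAle ih' ih add0n => ->.
    exact: sT.
  - case: i hi => // i hi.
    by have := rb i.+1; have := rb i; rewrite /bump leqW // -ltnS hi => -> ->.
  by rewrite rS rh ltnW // ltnNge -hk ltnn.
have lch : last_col T' h = k by rewrite /last_col rh.
have tT' : tlt_of_size n.+2 T'.
  split=> //; last by rewrite szT' r0 addSn szT.
  by rewrite r0 szT'; apply: tree_cond_tr.
split=> //=; first by rewrite ltnS; apply: leq_trans (tlt_size_le tT).
  rewrite /above_corner /last_point lch Prow eqxx ah /corner_row rh rS.
  by rewrite ltnS leqNgt -hk ltnn.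
by rewrite /delete_row /= lch insert_atK.
Qed.

(** * The two counts and the induction *)

Lemma sum_oc_tlt n : \sum_(T : tlt n) oc T = #|{: tlt n}|.
Proof.
rewrite -sum1_card.
suff : \sum_(T : tlt n) \sum_(i < n) corner_row T i =
       \sum_(T : tlt n) (\sum_(i < n) inner_row T i + 1).
  rewrite big_split /= -sum_empty_corners => corners.
  (* Adding the empty corners to both sides turns the left side into the number of all corners. *)
  apply/eqP; rewrite -(eqn_add2l (\sum_(T : tlt n) \sum_(i < n)
    (corner_row T i && ~~ last_point T i))) -corners -big_split; apply/eqP.
  apply: eq_bigr => T _; rewrite (ocE (tlt_size_le (tlt_of_sizeT T))) -big_split.
  by apply: eq_bigr => i _ /=; case: corner_row => //; case: last_point.
apply: eq_bigr => T _; rewrite addn1.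
have tT := tlt_of_sizeT T; have [sT [/point_cell/andP[T0 _] _ Pr _] _] := tT.
apply: corners_inner => //; first by rewrite T0 tlt_size_le.
have [|j /point_cell/andP[_]] := Pr (size (T : filling)).-1; first by rewrite prednK.
exact: leq_ltn_trans.
Qed.

Lemma sum_oc_tltS n : \sum_(T : tlt n.+2) oc T = n.+2 * #|{: tlt n.+1}|.
Proof.
have -> : \sum_(T : tlt n.+2) oc T =
    \sum_(T : tlt n.+2) \sum_(i < n.+2) left_corner T i +
    \sum_(T : tlt n.+2) \sum_(i < n.+2) above_corner T i.
  rewrite -big_split; apply: eq_bigr => T _.
  have tT := tlt_of_sizeT T.
  rewrite (ocE (tlt_size_le tT)) -big_split; apply: eq_bigr => i _ /=.
  rewrite /left_corner /above_corner.
  case: (boolP (corner_row T i)) => //= ci; case: (boolP (last_point T i)) => //= pi.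
  by have := corner_before tT ci pi; do 2!case: before.
rewrite sum_left_corners sum_above_corners -big_split mulnC -sum_nat_const.
apply: eq_bigr => T _; have tT := tlt_of_sizeT T.
(* The marks of one tableau number its rows plus its columns, hence [n.+2]. *)
have count m : m <= n.+1 -> \sum_(k < n.+1) (k < m) = m.
  move=> mn; rewrite -[RHS]card_ord -sum1_card.
  rewrite (big_ord_widen _ (fun=> 1) mn) [RHS]big_mkcond.
  by apply: eq_bigr => k _; case: ltnP.
rewrite /= !count ?tlt_size_le ?tlt_width_le //.
by case: tT.
Qed.

Lemma tlt_of_size1P T : tlt_of_size 1 T <-> T = [:: [:: true]].
Proof.
split=> [[_ [P00 _ _ _] szT] | ->].
  case: T P00 szT => [|r [|r' T]] //; last first.
    by rewrite /is_point /row_length /=; case: r => //= b r _; lia.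
  by rewrite /is_point /row_length /=; case: r => [|b [|b' r]] //= ->.
split=> //; first by case=> [|[|i]].
split=> // [i j /point_cell/andP[/=]|i i1|j j1]; last 2 first.
- by exists 0; case: i i1.
- by exists 0; case: j j1.
by case: i => // _; case: j.
Qed.

(** Equating [sum_oc_tlt] and [sum_oc_tltS] multiplies the count by [n.+2] from size [n.+1] to
    [n.+2]; in size 1 only the single cell occurs. *)
Lemma card_tlt n : #|{: tlt n.+1}| = n.+1`!.
Proof.
elim: n => [|n IH]; last by rewrite -sum_oc_tlt sum_oc_tltS IH.
have /tlt_of_sizeP t1 : tlt_of_size 1 [:: [:: true]] by apply/tlt_of_size1P.
apply: (@eq_card1 _ (TLT t1)) => T; rewrite !inE; apply/esym/eqP/val_inj.
exact/tlt_of_size1P/tlt_of_sizeT.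
Qed.

Theorem theorem3p2 (n : nat) (n_gt0 : 0 < n) : \sum_(T : tlt n) oc T = n`!.
Proof. by case: n n_gt0 => // n _; rewrite sum_oc_tlt card_tlt. Qed.
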